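(* Let $\alpha>0$, $b>1$, $a=b^{\alpha}$ and $\rho=1/b$. Let $\{Y(t),t\ge 0\}$ be an extremal process with stationary max-increments such that the distribution of $Y(1)$ is non-degenerate. Let $X_0\stackrel{d}{=}Y(1)$, let $\{\varepsilon_n\}_{n\ge 1}$ be i.i.d. random variables, independent of $X_0$, with $\varepsilon_n\stackrel{d}{=}\rho\,Y(b^{\alpha}-1)$ for all $n$, and define $$X_n=\rho X_{n-1}\vee\varepsilon_n,\qquad n\ge 1 .$$ If $\{Y(t)\}$ is $(a,\frac1\alpha)$-semi-selfsimilar, then the sequence $\{X_n\}$ is marginally stationary with extended Frechet type max-semi-stable$(a,b)$ marginals (with exponent $\alpha$). Conversely, if the sequence $\{X_n\}$ is marginally stationary, then $\{Y(t)\}$ is $(a,\frac1\alpha)$-semi-selfsimilar and the marginals of $\{X_n\}$ are extended Frechet type max-semi-stable$(a,b)$ (with exponent $\alpha$).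
   Context: All random variables are real-valued; $x\vee y=\max(x,y)$. Extremal process (EP): a real-valued stochastic process $\{Y(t)\}$ with increasing right-continuous sample paths and independent max-increments: for $0<s<t$, $Y(t)=Y(s)\vee U_{s,t}$ with $U_{s,t}$ independent of $\{Y(r):r\le s\}$. It has stationary max-increments if the law of $U_{s,t}$ depends only on $t-s$, with univariate marginals $P(Y(t)\le u)=\{G(u)\}^{t}$ for all $t>0$, $u\in\mathbf{R}$, where $G$ is the distribution function of $Y(1)$. The univariate marginals of an EP determine its finite-dimensional distributions. All statements about the process concern times $t>0$. A non-degenerate distribution function $F$ is extended Frechet type max-semi-stable$(a,b)$ with exponent $\alpha>0$ if $b>1$, $a>1$, $ab^{-\alpha}=1$ and $F(x)=\exp\{-x^{-\alpha}h(\ln x)\}$ for $x>0$ (and $F(x)=0$ for $x\le 0$), where $h$ is a positive bounded periodic function with period $\ln b$. Semi-selfsimilarity: for $c>0$ and $H\in\mathbf{R}$, $\{Y(t)\}$ is $(c,H)$-semi-selfsimilar if $\{Y(ct)\}\stackrel{d}{=}\{c^{H}Y(t)\}$ (equality of finite-dimensional distributions). In terms of the distribution function $G$ of $Y(1)$ this is equivalent to $\{G(c^{H}u)\}^{ct}=\{G(u)\}^{t}$. Marginally stationary means $X_n\stackrel{d}{=}X_{n-1}$ for all integers $n\ge 1$. *)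

(* Defs.v *)
From HB Require Import structures.
From mathcomp Require Import all_boot all_order all_algebra.
From mathcomp Require Import finmap.
From mathcomp Require Import all_classical all_reals all_analysis.

Set Implicit Arguments.
Unset Strict Implicit.
Unset Printing Implicit Defensive.

Import Order.TTheory GRing.Theory Num.Theory.
Import numFieldNormedType.Exports.

Local Open Scope classical_set_scope.
Local Open Scope ring_scope.

(* Equality in distribution of two random elements, possibly on different
   probability spaces. It is meant for measurable [X] and [X']; taking plain
   functions lets it apply to real-valued and tuple-valued maps alike. *)
Definition eq_law (R : realType) (d d' ds : measure_display)
    (T : measurableType d) (T' : measurableType d') (S : measurableType ds)
    (P : probability T R) (P' : probability T' R)
    (X : T -> S) (X' : T' -> S) : Prop :=
  forall B : set S, measurable B -> P (X @^-1` B) = P' (X' @^-1` B).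

Definition sigma_family (R : realType) (d : measure_display)
    (T : measurableType d) (P : probability T R) (I : Type) (D : set I)
    (Z : I -> {RV P >-> R}) : set (set T) :=
  <<s \bigcup_(i in D) preimage_set_system [set: T] (Z i) measurable >>.

Definition indep_of_family (R : realType) (d : measure_display)
    (T : measurableType d) (P : probability T R) (I : Type) (D : set I)
    (X : {RV P >-> R}) (Z : I -> {RV P >-> R}) : Prop :=
  forall (B : set R) (A : set T), measurable B -> sigma_family D Z A ->
    P ((X @^-1` B) `&` A) = (P (X @^-1` B) * P A)%E.

Definition mutually_indep (R : realType) (d : measure_display)
    (T : measurableType d) (P : probability T R) (I : choiceType) (D : set I)
    (Z : I -> {RV P >-> R}) : Prop :=
  forall (J : {fset I}) (B : I -> set R),
    [set` J] `<=` D -> (forall j, measurable (B j)) ->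
    P (\bigcap_(j in [set` J]) (Z j @^-1` B j)) =
    (\prod_(j <- J) P (Z j @^-1` B j))%E.

Definition iid (R : realType) (d : measure_display)
    (T : measurableType d) (P : probability T R) (I : choiceType) (D : set I)
    (Z : I -> {RV P >-> R}) : Prop :=
  mutually_indep D Z /\
  (forall i j, D i -> D j -> eq_law P P (Z i) (Z j)).

(* Real-valued version of the library's [cdf], which lands in [\bar R]. *)
Definition cdfR (R : realType) (d : measure_display) (T : measurableType d)
    (P : probability T R) (X : {RV P >-> R}) : R -> R :=
  fun u => fine (cdf X u).

Definition distribution_function (R : realType) (F : R -> R) : Prop :=
  [/\ {homo F : x y / x <= y}, right_continuous F,
      F x @[x --> -oo] --> (0 : R) & F x @[x --> +oo] --> (1 : R)].

(* [F] is not the distribution function of a point mass. *)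
Definition nondegenerate_df (R : realType) (F : R -> R) : Prop :=
  ~ exists c : R, forall x, F x = (c <= x)%R%:R.

(* Processes are indexed by all of [R], but only the times t > 0 are ever
   constrained or used; the remaining values are irrelevant. *)

(* [U s t] is, for 0 < s < t, a max-increment of [Y] over ]s, t]. Increments
   are not determined by [Y] (not even in law), hence the parameter [U]. *)
Definition max_increments (R : realType) (d : measure_display)
    (T : measurableType d) (P : probability T R) (Y : R -> {RV P >-> R})
    (U : R -> R -> {RV P >-> R}) : Prop :=
  forall s t : R, 0 < s -> s < t ->
    (forall w, Y t w = Num.max (Y s w) (U s t w)) /\
    indep_of_family [set r | 0 < r <= s] (U s t) Y.

Definition extremal_process (R : realType) (d : measure_display)
    (T : measurableType d) (P : probability T R)
    (Y : R -> {RV P >-> R}) : Prop :=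
  [/\ forall w (s t : R), 0 < s -> s <= t -> Y s w <= Y t w,
      forall w (t : R), 0 < t -> Y r w @[r --> t^'+] --> Y t w &
      exists U : R -> R -> {RV P >-> R}, max_increments Y U].

Definition stationary_max_increments (R : realType) (d : measure_display)
    (T : measurableType d) (P : probability T R)
    (Y : R -> {RV P >-> R}) : Prop :=
  (exists U : R -> R -> {RV P >-> R},
     max_increments Y U /\
     (forall s t s' t' : R, 0 < s -> s < t -> 0 < s' -> s' < t' ->
        t - s = t' - s' -> eq_law P P (U s t) (U s' t'))) /\
  (forall t u : R, 0 < t -> cdfR (Y t) u = cdfR (Y 1) u `^ t).

(* Equality of the finite-dimensional distributions at times t > 0; tuples
   carry the product sigma-algebra. *)
Definition eq_fdd (R : realType) (d d' : measure_display)
    (T : measurableType d) (T' : measurableType d')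
    (P : probability T R) (P' : probability T' R)
    (Y : R -> T -> R) (Z : R -> T' -> R) : Prop :=
  forall (n : nat) (t : n.-tuple R), (forall i, 0 < tnth t i) ->
    eq_law P P' (fun w => [tuple Y (tnth t i) w | i < n])
                (fun w => [tuple Z (tnth t i) w | i < n]).

Definition semi_selfsimilar (R : realType) (d : measure_display)
    (T : measurableType d) (P : probability T R)
    (c H : R) (Y : R -> {RV P >-> R}) : Prop :=
  0 < c /\ eq_fdd P P (fun t w => Y (c * t) w) (fun t w => c `^ H * Y t w).

Definition frechet_max_semistable (R : realType) (a b alpha : R)
    (F : R -> R) : Prop :=
  [/\ distribution_function F, nondegenerate_df F, 0 < alpha,
      [/\ 1 < b, 1 < a & a * b `^ (- alpha) = 1] &
      exists h : R -> R,
        [/\ forall y, 0 < h y,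
            exists M : R, forall y, h y <= M,
            periodic h (ln b),
            forall x : R, 0 < x -> F x = expR (- (x `^ (- alpha) * h (ln x))) &
            forall x : R, x <= 0 -> F x = 0]].

Definition marginally_stationary (R : realType) (d : measure_display)
    (T : measurableType d) (P : probability T R)
    (X : nat -> {RV P >-> R}) : Prop :=
  forall n, (1 <= n)%N -> eq_law P P (X n) (X n.-1).

(* Main.v *)
Require Import Defs.
From HB Require Import structures.
From mathcomp Require Import all_boot all_order all_algebra.
From mathcomp Require Import finmap.
From mathcomp Require Import all_classical all_reals all_analysis.
From mathcomp Require Import measurable_realfun ring.

Set Implicit Arguments.
Unset Strict Implicit.
Unset Printing Implicit Defensive.

Import Order.TTheory GRing.Theory Num.Theory.
Import numFieldNormedType.Exports.

Local Open Scope classical_set_scope.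
Local Open Scope ring_scope.

(* Both semi-selfsimilarity of [Y] and marginal stationarity of [X] amount to
   the functional equation [G (b u) ^ a = G u] for the distribution function [G]
   of [Y 1]. Since [X n <= u] unfolds into [X 0 <= b^n u] and
   [eps j <= b^(n-j) u] for [1 <= j <= n], the law of [X n] is
   [G (b^n u) * \prod_j G (b^(n-j+1) u) ^ (a-1)], which telescopes to [G u] under
   that equation and reduces to [G (b u) ^ a] for [n = 1]. The equation forces
   [0 < G < 1] on the positive reals and [G = 0] elsewhere, so that
   [h y = - ln (G (e^y)) e^(alpha y)] is positive, bounded and periodic.
   Finally, the independence of the max-increments expresses the joint
   distribution functions of [Y] through [G], and the equation yields the
   equality of the finite-dimensional distributions. *)

(** * Distribution functions with a scaling relation *)

Lemma powR_gt1 (R : realType) (x y : R) : 1 < x -> 0 < y -> 1 < x `^ y.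
Proof.
move=> x1 y0; have x0 : 0 < x by apply: lt_trans x1.
by rewrite /powR gt_eqF// -[ltLHS]expR0 ltr_expR mulr_gt0// ln_gt0.
Qed.

(** Used to carry one point past another by repeated scaling. The powers of [b^-1] tend to 0, so one
    of them falls below [y^-1]. *)
Lemma expr_gt_exists (R : archiRealFieldType) (b y : R) :
  1 < b -> exists n, y < b ^+ n.
Proof.
move=> b1; have b0 : 0 < b by apply: lt_trans b1.
have [y0|y0] := leP y 0; first by exists 0%N; rewrite expr0; apply: le_lt_trans y0 _.
have /cvgr0Pnorm_lt/(_ y^-1) : (GRing.exp b^-1 : R ^nat) @ \oo --> (0 : R).
  by apply: cvg_expr; rewrite ger0_norm ?invr_ge0 ?ltW// invf_lt1.
rewrite invr_gt0 => /(_ y0)[n _ /(_ n (leqnn n))] /=.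
by rewrite normrX normfV gtr0_norm// exprVn ltf_pV2 ?posrE ?exprn_gt0// => ?; exists n.
Qed.

Section distribution_function_theory.
Variables (R : realType) (G : R -> R).
Hypothesis Gdf : distribution_function G.

Lemma df_homo : {homo G : x y / x <= y}. Proof. by case: Gdf. Qed.

Lemma df_gt_at_infty u z : z < 1 -> exists2 x, u <= x & z < G x.
Proof.
case: Gdf => _ _ _ Gy z1; near (pinfty_nbhs R) => x; exists x.
  by near: x; apply: nbhs_pinfty_ge; exact: num_real.
by near: x; exact: cvgr_gt Gy _ z1.
Unshelve. all: by end_near. Qed.

Lemma df_lt_at_ninfty u z : 0 < z -> exists2 x, x <= u & G x < z.
Proof.
case: Gdf => _ _ GNy _ z0; near (ninfty_nbhs R) => x; exists x.
  by near: x; apply: nbhs_ninfty_le; exact: num_real.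
by near: x; exact: cvgr_lt GNy _ z0.
Unshelve. all: by end_near. Qed.

Lemma df_lt_at_right u z : G u < z -> exists2 x, u < x & G x < z.
Proof.
case: Gdf => _ Gr _ _ uz; near (at_right u) => x; exists x => //.
by near: x; exact: cvgr_lt (Gr u) _ uz.
Unshelve. all: by end_near. Qed.

Lemma df_ge0 u : 0 <= G u.
Proof.
rewrite leNgt; apply/negP => u0; case: Gdf => _ _ GNy _.
near (ninfty_nbhs R) => x; have : G x <= G u.
  by apply: df_homo; near: x; apply: nbhs_ninfty_le; exact: num_real.
by apply/negP; rewrite -ltNge; near: x; exact: cvgr_gt GNy _ u0.
Unshelve. all: by end_near. Qed.

Lemma df_le1 u : G u <= 1.
Proof.
rewrite leNgt; apply/negP => u1; case: Gdf => _ _ _ Gy.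
near (pinfty_nbhs R) => x; have : G u <= G x.
  by apply: df_homo; near: x; apply: nbhs_pinfty_ge; exact: num_real.
by apply/negP; rewrite -ltNge; near: x; exact: cvgr_lt Gy _ u1.
Unshelve. all: by end_near. Qed.

End distribution_function_theory.

Lemma periodicz (V W : zmodType) (f : V -> W) T :
  periodic f T -> forall (k : int) x, f (x + T *~ k) = f x.
Proof.
move=> fT [] n x; first by rewrite periodicn.
rewrite NegzE mulrNz -[in RHS](subrK (T *+ n.+1) x).
by rewrite periodicn.
Qed.

Section scaling.
Variables (R : realType) (alpha b : R) (G : R -> R).
Hypotheses (alpha0 : 0 < alpha) (b1 : 1 < b).
Hypotheses (Gdf : distribution_function G) (Gnd : nondegenerate_df G).
Hypothesis GE : forall u, G (b * u) `^ (b `^ alpha) = G u.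

Let b0 : 0 < b. Proof. exact: lt_trans b1. Qed.
Let a0 : 0 < b `^ alpha. Proof. exact: powR_gt0. Qed.
Let a1 : 1 < b `^ alpha. Proof. exact: powR_gt1. Qed.

Lemma scaling_eq1 u : (G (b * u) == 1) = (G u == 1).
Proof.
rewrite -(GE u) powR_eq1 (gt_eqF a0) orbF.
(* A negative base also has power 1, since [ln] is 0 there by convention; nonnegativity of [G]
   excludes this case. *)
by rewrite ltNge df_ge0// orbF.
Qed.

Lemma scaling_eq0 u : (G (b * u) == 0) = (G u == 0).
Proof. by rewrite -(GE u) powR_eq0 (gt_eqF a0) andbT. Qed.

Lemma scalingX_eq1 n u : (G (b ^+ n * u) == 1) = (G u == 1).
Proof.
elim: n u => [|n IHn] u; first by rewrite expr0 mul1r.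
by rewrite exprSr -mulrA IHn scaling_eq1.
Qed.

Lemma scalingX_eq0 n u : (G (b ^+ n * u) == 0) = (G u == 0).
Proof.
elim: n u => [|n IHn] u; first by rewrite expr0 mul1r.
by rewrite exprSr -mulrA IHn scaling_eq0.
Qed.

(** For [x > 0], taking logarithms gives [(b^alpha - 1) ln x = 0], and [b^alpha > 1]. *)
Lemma powR_fixed01 (x : R) : 0 <= x -> x `^ (b `^ alpha) = x -> x = 0 \/ x = 1.
Proof.
rewrite le_eqVlt => /predU1P[<-|x0 xa]; first by left.
right; apply/eqP; rewrite -ln_eq0//.
have : ln x * (b `^ alpha - 1) = 0.
  by rewrite mulrBr mulr1 mulrC -ln_powR xa subrr.
by move/eqP; rewrite mulf_eq0 subr_eq0 (gt_eqF a1) orbF.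
Qed.

(** For [u < 0] we have [b u <= u], while raising a number of [0, 1] to a power above 1 decreases
    it. Hence [G (b u) <= G u = G (b u) ^ a <= G (b u)] with [a = b^alpha], so [G u] is a fixed
    point of the power, 0 or 1. The value 1 would propagate to all [b^n u], which go to minus
    infinity, against the limit 0. *)
Lemma scaling_lt0 u : u < 0 -> G u = 0.
Proof.
move=> u0; have Gbu : G (b * u) = G u.
  apply/eqP; rewrite eq_le; apply/andP; split.
    by apply: df_homo => //; rewrite ger_nMl// ltW.
  rewrite -[leLHS]GE.
  have /predU1P[<-|G0] : (0 == G (b * u)) || (0 < G (b * u)).
  - by rewrite -le_eqVlt df_ge0.
  - by rewrite powR0// gt_eqF.
  - by apply: ge1r_powR; rewrite ?G0 ?df_le1// ltW.
have [//|Gu1] : G u = 0 \/ G u = 1.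
  by apply: powR_fixed01; rewrite ?df_ge0// -{1}Gbu GE.
have [x xu Gx] := df_lt_at_ninfty Gdf u ltr01.
have [n xn] := expr_gt_exists (x / u) b1.
have : 1 <= G x; last by rewrite leNgt Gx.
have /eqP <- : G (b ^+ n * u) == 1 by rewrite scalingX_eq1 Gu1.
by apply: df_homo => //; rewrite -ler_ndivrMr// ltW.
Qed.

(** At 0 the equation makes [G 0] a fixed point of the power; the value 1 would turn [G] into the
    point mass at 0, which non-degeneracy excludes. *)
Lemma scaling_le0 u : u <= 0 -> G u = 0.
Proof.
rewrite le_eqVlt => /predU1P[->|]; last exact: scaling_lt0.
have [//|G01] : G 0 = 0 \/ G 0 = 1.
  by apply: powR_fixed01; rewrite ?df_ge0// -{2}GE mulr0.
exfalso; apply: Gnd; exists 0 => x; have [x0|x0] := leP 0 x.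
  by apply/eqP; rewrite mulr1n eq_le df_le1//= -[leLHS]G01 df_homo.
exact: scaling_lt0.
Qed.

(** A zero at [u > 0] would propagate to all [b^n u], against the limit 1 at infinity. *)
Lemma scaling_gt0 u : 0 < u -> 0 < G u.
Proof.
move=> u0; rewrite lt_def df_ge0// andbT; apply/negP => /eqP Gu0.
have [x _ Gx] := df_gt_at_infty Gdf 0 ltr01.
have [n xn] := expr_gt_exists (x / u) b1.
have : G x <= 0; last by rewrite leNgt Gx.
have /eqP <- : G (b ^+ n * u) == 0 by rewrite scalingX_eq0 Gu0.
by apply: df_homo => //; rewrite -ler_pdivrMr// ltW.
Qed.

(** Right continuity at 0, where [G] vanishes, gives some [x > 0] with [G x < 1]; the value 1 at [u]
    would propagate down to [b^-n u <= x]. *)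
Lemma scaling_lt1 u : 0 < u -> G u < 1.
Proof.
move=> u0; rewrite lt_neqAle df_le1// andbT; apply/negP => /eqP Gu1.
have [x x0 Gx] : exists2 x, 0 < x & G x < 1.
  by apply: df_lt_at_right => //; rewrite scaling_le0.
have [n xn] := expr_gt_exists (u / x) b1.
have : 1 <= G x; last by rewrite leNgt Gx.
have /eqP <- : G (b ^- n * u) == 1.
  by rewrite -(scalingX_eq1 n) mulrA mulfV ?mul1r ?Gu1// gt_eqF// exprn_gt0.
apply: df_homo => //.
by rewrite mulrC ler_pdivrMr ?exprn_gt0// mulrC -ler_pdivrMr// ltW.
Qed.

Let h y := - ln (G (expR y)) * expR y `^ alpha.

(** Shifting by [ln b] replaces [e^y] by [b e^y]; the factor [b^alpha] so gained is the exponent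
    that the equation takes out of [ln (G (e^y))]. *)
Let h_periodic : periodic h (ln b).
Proof.
move=> y; have -> : h (y + ln b) = - ln (G (b * expR y)) * (b * expR y) `^ alpha.
  by rewrite /h expRD lnK ?posrE// [expR y * b]mulrC.
rewrite powRM ?expR_ge0 ?(ltW b0)// /h -[in RHS]GE ln_powR; ring.
Qed.

Let h_bounded : exists M, forall y, h y <= M.
Proof.
have lb : 0 < ln b by rewrite ln_gt0.
(* Periodicity reduces [y] to [z] in [0, ln b]. There the decreasing factor [- ln (G (e^z))] is at
   most its value at 0, and the increasing factor [e^(alpha z)] at most its value at [ln b]. *)
exists (- ln (G 1) * b `^ alpha) => y.
pose k := Num.floor (y / ln b).
rewrite -(subrK (ln b *~ k) y) (periodicz h_periodic).
set z := y - _.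
have z0 : 0 <= z.
  by rewrite subr_ge0 -mulrzr mulrC -ler_pdivlMr// floor_le.
have zb : z <= ln b.
  rewrite lerBlDr -{1}(mulr1 (ln b)) -mulrzr -mulrDr mulrC -ler_pdivrMr// ltW//.
  rewrite addrC; by rewrite -(intrD _ _ 1) floorD1_gt.
have G1 : 0 < G 1 by exact: scaling_gt0.
apply: ler_pM; rewrite ?powR_ge0 ?oppr_ge0 ?ln_le0 ?df_le1 ?lerN2//.
  by rewrite ler_ln ?posrE ?scaling_gt0 ?expR_gt0// df_homo// -expR0 ler_expR.
apply: ge0_ler_powR; rewrite ?nnegrE ?expR_ge0 ?(ltW b0) ?(ltW alpha0)//.
by rewrite -[leRHS]lnK ?posrE// ler_expR.
Qed.

Lemma scaling_frechet : frechet_max_semistable (b `^ alpha) b alpha G.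
Proof.
split => //; first by split; rewrite // powRN mulfV// gt_eqF.
exists h; split => //.
- move=> y; rewrite mulr_gt0 ?powR_gt0 ?expR_gt0// oppr_gt0.
  by rewrite ln_lt0// scaling_gt0 ?expR_gt0//= scaling_lt1 ?expR_gt0.
- move=> x x0; rewrite /h lnK ?posrE// powRN.
  rewrite mulrCA mulVf ?gt_eqF ?powR_gt0// mulr1 opprK lnK// posrE.
  exact: scaling_gt0.
- exact: scaling_le0.
Qed.

End scaling.

(** * Laws determined by their values on orthants *)

Section eq_law_orthants.
Context (R : realType) (ds : measure_display) (S : measurableType ds).
Variables (I : Type) (c : I -> S -> R).

(** Constraints form a list in which coordinates may repeat or be absent, so that intersection is
    concatenation and the empty list gives the whole space. *)
Definition orthant (s : seq (I * R)) : set S :=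
  [set x | all (fun p => c p.1 x <= p.2) s].

Hypothesis mS : @measurable _ S =
  <<s \bigcup_i preimage_set_system [set: S] (c i) measurable >>.

Lemma orthant_nil : orthant [::] = setT.
Proof. by apply/seteqP. Qed.

Lemma orthant_cons p s :
  orthant (p :: s) = c p.1 @^-1` `]-oo, p.2] `&` orthant s.
Proof.
apply/seteqP; split=> x /=; rewrite in_itv/=; first by move=> /andP[].
by move=> [? ?]; apply/andP.
Qed.

Lemma orthant_measurable s : measurable (orthant s).
Proof.
elim: s => [|p s IHs]; first by rewrite orthant_nil.
rewrite orthant_cons; apply: measurableI => //.
rewrite mS; apply: sub_sigma_algebra; exists p.1 => //.
by exists `]-oo, p.2]%classic; rewrite ?setTI.
Qed.

Lemma measurable_orthants : @measurable _ S = <<s range orthant >>.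
Proof.
apply/seteqP; split; last first.
  apply: smallest_sub; first exact: sigma_algebra_measurable.
  by move=> _ [s _ <-]; exact: orthant_measurable.
rewrite mS; apply: smallest_sub; first exact: smallest_sigma_algebra.
move=> _ [i _ [B mB <-]].
suff: measurable_fun [set: g_sigma_algebraType (range orthant)] (c i).
  by move=> /(_ measurableT _ mB).
apply: (measurability _ (RGenOInfty.measurableE R)).
move=> _ [_ [r ->] <-]; rewrite setTI -setCitvl preimage_setC.
apply: measurableC; apply: sub_sigma_algebra; exists [:: (i, r)] => //.
by rewrite orthant_cons orthant_nil setIT.
Qed.

(** Uniqueness of measures on a generating pi-system: orthants are stable under intersection, and
    the whole space is one of them. *)
Lemma eq_law_orthant (d d' : measure_display) (T : measurableType d)
    (T' : measurableType d') (P : probability T R) (P' : probability T' R)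
    (X : {mfun T >-> S}) (X' : {mfun T' >-> S}) :
  (forall s, P (X @^-1` orthant s) = P' (X' @^-1` orthant s)) ->
  eq_law P P' X X'.
Proof.
move=> XX' B mB.
apply: (measure_unique (range orthant) (fun=> setT) measurable_orthants
  _ _ _ (distribution P X) (distribution P' X')) => //.
- move=> _ _ [s _ <-] [t _ <-]; exists (s ++ t) => //.
  apply/seteqP; split=> x /=; rewrite /orthant/= all_cat; first by move/andP.
  by move=> [? ?]; apply/andP.
- by move=> _; exists [::] => //; exact: orthant_nil.
- by rewrite bigcup_const//; exists 0%N.
- by move=> _ [s _ <-]; exact: XX'.
- by move=> _; rewrite /= ltey_eq fin_num_measure.
Qed.

End eq_law_orthants.

Lemma eq_law_cdf (R : realType) (d d' : measure_display) (T : measurableType d)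
    (T' : measurableType d') (P : probability T R) (P' : probability T' R)
    (X : {RV P >-> R}) (X' : {RV P' >-> R}) :
  cdfR X =1 cdfR X' -> eq_law P P' X X'.
Proof.
move=> XX'; apply: (@eq_law_orthant _ _ _ unit (fun _ x => x)).
  apply/seteqP; split=> [B mB|].
    by apply: sub_sigma_algebra; exists tt => //; exists B; rewrite ?setTI.
  apply: smallest_sub; first exact: sigma_algebra_measurable.
  by move=> _ [_ _ [B mB <-]]; rewrite setTI.
case=> [|p s]; first by rewrite orthant_nil !preimage_setT !probability_setT.
(* With a single coordinate, a nonempty list of bounds amounts to the least of them; [p] stays at
   the head as the starting value of the fold. *)
have -> : orthant (fun _ => id) (p :: s) = `]-oo, foldr Num.min p.2 (map snd s)]%classic.
  elim: s => [|q s IHs].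
    by rewrite orthant_cons /=; apply/seteqP; split=> [x []|x].
  rewrite orthant_cons orthant_cons setICA -orthant_cons IHs.
  by apply/seteqP; split=> x /=; rewrite !in_itv/= le_min => /andP.
have := congr1 EFin (XX' (foldr Num.min p.2 (map snd s))).
by rewrite /cdfR !fineK ?fin_num_measure.
Qed.

Lemma eq_law_tuple (R : realType) (d d' : measure_display)
    (T : measurableType d) (T' : measurableType d')
    (P : probability T R) (P' : probability T' R) n
    (Y : 'I_n -> {RV P >-> R}) (Y' : 'I_n -> {RV P' >-> R}) :
  (forall s : seq ('I_n * R),
    P [set w | all (fun p => Y p.1 w <= p.2) s] =
    P' [set w | all (fun p => Y' p.1 w <= p.2) s]) ->
  eq_law P P' (fun w => [tuple Y i w | i < n]) (fun w => [tuple Y' i w | i < n]).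
Proof.
move=> YY'.
have mt d0 (T0 : measurableType d0) (Z : 'I_n -> {mfun T0 >-> R}) :
    measurable_fun setT (fun w => [tuple Z i w | i < n]).
  apply/measurable_fun_tnthP => i; apply: (eq_measurable_fun (Z i)) => // w _.
  by rewrite /= tnth_mktuple.
pose f : {mfun T >-> n.-tuple R} :=
  HB.pack (fun w => [tuple Y i w | i < n]) (isMeasurableFun.Build _ _ _ _ _ (mt _ _ Y)).
pose f' : {mfun T' >-> n.-tuple R} :=
  HB.pack (fun w => [tuple Y' i w | i < n]) (isMeasurableFun.Build _ _ _ _ _ (mt _ _ Y')).
apply: (@eq_law_orthant _ _ _ 'I_n (fun i x => tnth x i) _ _ _ _ _ P P' f f').
  rewrite [LHS]/measurable/= /g_sigma_preimage -bigcup_seq; congr (<<s _ >>).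
  by apply: eq_bigcupl; split=> i //= _; exact: mem_index_enum.
move=> s; have E d0 (T0 : measurableType d0) (Z : 'I_n -> {mfun T0 >-> R}) :
    (fun w => [tuple Z i w | i < n]) @^-1` orthant (fun i x => tnth x i) s =
    [set w | all (fun p => Z p.1 w <= p.2) s].
  apply/funext => w; congr is_true; apply: eq_all => p.
  by rewrite tnth_mktuple.
by rewrite /f /f' /= !E.
Qed.

(** * Joint distributions of an extremal process *)

Section cdfR_theory.
Context (R : realType) (d : measure_display) (T : measurableType d).
Context (P : probability T R) (X : {RV P >-> R}).

Lemma EFin_cdfR u : (cdfR X u)%:E = P (X @^-1` `]-oo, u]).
Proof. by rewrite /cdfR fineK ?fin_num_measure. Qed.

Lemma cdfR_df : distribution_function (cdfR X).
Proof.
split.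
- by move=> u v uv; rewrite /cdfR fine_le ?fin_num_measure ?cdf_nondecreasing.
- move=> u; apply: fine_cvg.
  by rewrite fineK ?fin_num_measure//; exact: cdf_right_continuous.
- by apply/fine_cvg/cvg_cdfNy0.
- by apply/fine_cvg/cvg_cdfy1.
Qed.

End cdfR_theory.

Lemma eq_law_cdfR (R : realType) (d d' : measure_display) (T : measurableType d)
    (T' : measurableType d') (P : probability T R) (P' : probability T' R)
    (X : {RV P >-> R}) (X' : {RV P' >-> R}) :
  eq_law P P' X X' -> cdfR X =1 cdfR X'.
Proof. by move=> XX' u; apply: EFin_inj; rewrite !EFin_cdfR XX'. Qed.

Section extremal_joint.
Context (R : realType) (d : measure_display) (T : measurableType d).
Context (P : probability T R) (Y : R -> {RV P >-> R}).

Definition joint_le (s : seq (R * R)) : set T :=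
  [set w | all (fun p => Y p.1 w <= p.2) s].

Lemma sigma_familyT (I : Type) (D : set I) (Z : I -> {RV P >-> R}) :
  sigma_family D Z setT.
Proof.
exact: (@measurableT _ (g_sigma_algebraType
  (\bigcup_(i in D) preimage_set_system [set: T] (Z i) measurable))).
Qed.

Lemma sigma_familyI (I : Type) (D : set I) (Z : I -> {RV P >-> R}) A B :
  sigma_family D Z A -> sigma_family D Z B -> sigma_family D Z (A `&` B).
Proof.
exact: (@measurableI _ (g_sigma_algebraType
  (\bigcup_(i in D) preimage_set_system [set: T] (Z i) measurable))).
Qed.

Lemma sigma_family_preimage (I : Type) (D : set I) (Z : I -> {RV P >-> R}) i B :
  D i -> measurable B -> sigma_family D Z (Z i @^-1` B).
Proof.
move=> Di mB; apply: sub_sigma_algebra; exists i => //.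
by exists B; rewrite ?setTI.
Qed.

Lemma joint_le_nil : joint_le [::] = setT.
Proof. by apply/seteqP. Qed.

Lemma joint_le_cons p s :
  joint_le (p :: s) = Y p.1 @^-1` `]-oo, p.2] `&` joint_le s.
Proof.
apply/seteqP; split=> w /=; rewrite in_itv/=; first by move=> /andP[].
by move=> [? ?]; apply/andP.
Qed.

Lemma joint_le_min t u v s :
  joint_le ((t, u) :: (t, v) :: s) = joint_le ((t, Num.min u v) :: s).
Proof. by apply/funext => w; rewrite /joint_le /mkset /= le_min andbA. Qed.

Lemma joint_le_sigma (D : set R) s :
  (forall p, p \in s -> D p.1) -> sigma_family D Y (joint_le s).
Proof.
elim: s => [_|p s IHs Ds].
  by rewrite joint_le_nil; exact: sigma_familyT.
rewrite joint_le_cons; apply: sigma_familyI.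
  by apply: sigma_family_preimage => //; apply: Ds; rewrite mem_head.
by apply: IHs => q qs; apply: Ds; rewrite in_cons qs orbT.
Qed.

Lemma joint_le_measurable s : measurable (joint_le s).
Proof.
elim: s => [|p s IHs]; first by rewrite joint_le_nil.
by rewrite joint_le_cons; apply: measurableI => //; exact: measurable_funPTI.
Qed.

Variable U : R -> R -> {RV P >-> R}.
Hypothesis YU : max_increments Y U.
Hypothesis YG : forall t u : R, 0 < t -> cdfR (Y t) u = cdfR (Y 1) u `^ t.
Local Notation G := (cdfR (Y 1)).

(* The law of the increment over ]t2, t1] is not determined by [G] at the
   points [u1] where [G u1 = 0], but then both sides vanish. *)
Lemma joint_le_rec t1 u1 t2 u2 s : 0 < t2 -> t2 <= t1 ->
  (forall p, p \in s -> 0 < p.1 <= t2) ->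
  P (joint_le ((t1, u1) :: (t2, u2) :: s)) =
  (P (joint_le ((t2, Num.min u1 u2) :: s)) * (G u1 `^ (t1 - t2))%:E)%E.
Proof.
move=> t20; rewrite le_eqVlt => /predU1P[<- _|t21 st2].
  by rewrite subrr powRr0 mule1 joint_le_min.
have [Ymax Uindep] := YU t20 t21.
have Yt1 : Y t1 @^-1` `]-oo, u1] =
    U t2 t1 @^-1` `]-oo, u1] `&` Y t2 @^-1` `]-oo, u1].
  apply/seteqP; split=> w /=; rewrite !in_itv/= Ymax ge_max.
    by move=> /andP[].
  by move=> [-> ->].
(* Independence applied to [Y t1] alone: when [G u1] is positive, dividing yields the law of the
   increment at [u1]. *)
have Gt1 : (G u1 `^ t1)%:E = (P (U t2 t1 @^-1` `]-oo, u1]) * (G u1 `^ t2)%:E)%E.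
  rewrite -!YG ?(lt_trans t20 t21)// !EFin_cdfR Yt1 Uindep//.
  by apply: sigma_family_preimage; rewrite //= t20 lexx.
have -> : joint_le ((t1, u1) :: (t2, u2) :: s) =
    U t2 t1 @^-1` `]-oo, u1] `&` joint_le ((t2, Num.min u1 u2) :: s).
  by rewrite joint_le_cons/= Yt1 -setIA -[in LHS]/((t2, u1).1) -[in LHS]/((t2, u1).2)
    -joint_le_cons joint_le_min.
rewrite Uindep//; last first.
  apply: joint_le_sigma => p; rewrite in_cons => /predU1P[->|/st2//].
  by rewrite /= t20 lexx.
rewrite muleC; have [G0|G0] := eqVneq (G u1) 0.
  suff -> : P (joint_le ((t2, Num.min u1 u2) :: s)) = 0%E by rewrite !mul0e.
  apply/eqP; rewrite eq_le measure_ge0 andbT.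
  have -> : 0%E = P (Y t2 @^-1` `]-oo, u1]).
    by rewrite -EFin_cdfR YG// G0 powR0// gt_eqF.
  apply: le_measure; rewrite ?inE.
  - exact: joint_le_measurable.
  - exact: measurable_funPTI.
  - by rewrite -joint_le_min joint_le_cons => w [].
congr (_ * _)%E.
have Gp : 0 < G u1 by rewrite lt_def G0 fine_ge0.
rewrite powRB ?G0 ?implybT// EFinM Gt1.
by rewrite -muleA -EFinM mulfV ?mule1// gt_eqF// powR_gt0.
Qed.

Variables c k : R.
Hypotheses (c0 : 0 < c) (k0 : 0 < k).
Hypothesis Gck : forall u, G u `^ c = G (u / k).

(** Times decrease along the list, so [joint_le_rec] peels off the latest one. Its factor has
    exponent [c (t1 - t2)] on the left, and [Gck] turns this into the factor on the right. *)
Lemma joint_le_scale_sorted s :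
  sorted (fun p q : R * R => q.1 <= p.1) s -> (forall p, p \in s -> 0 < p.1) ->
  P (joint_le [seq (c * p.1, p.2) | p <- s]) =
  P (joint_le [seq (p.1, p.2 / k) | p <- s]).
Proof.
have tr : transitive (fun p q : R * R => q.1 <= p.1).
  by move=> p q r qp rp; exact: le_trans rp qp.
case: s => [//|[t1 u1] s].
elim: s t1 u1 => [|[t2 u2] s IHs] t1 u1 /=.
  move=> _ /(_ _ (mem_head _ _))/= t10.
  rewrite !joint_le_cons/= joint_le_nil !setIT.
  by rewrite -!EFin_cdfR (YG _ t10) (YG _ (mulr_gt0 c0 t10)) powRrM Gck.
move=> /andP[t21 ts] spos.
have t20 : 0 < t2.
  by have := spos (t2, u2); apply; rewrite !in_cons eqxx orbT.
have st2 : forall p, p \in s -> 0 < p.1 <= t2.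
  move=> p ps; rewrite spos ?in_cons ?ps ?orbT//=.
  by have /allP/(_ _ ps) := order_path_min tr ts.
rewrite !joint_le_rec ?mulr_gt0 ?ler_pM2l//.
- rewrite -mulrBr powRrM Gck; congr (_ * _)%E.
  (* The merged bound commutes with division by [k], so the shorter list again has the form required
     by the induction hypothesis. *)
  rewrite -minr_pMl ?invr_ge0 ?(ltW k0)//.
  apply: (IHs t2 (Num.min u1 u2)).
    by move: ts; rewrite /= !path_sortedE.
  by move=> p; rewrite in_cons => /predU1P[->//|/st2/andP[]].
- by move=> _ /mapP[p ps ->] /=; exact: st2.
- move=> _ /mapP[p ps ->] /=; have /andP[p0 pt] := st2 p ps.
  by rewrite mulr_gt0//= ler_pM2l.
Qed.

Lemma joint_le_scale s : (forall p, p \in s -> 0 < p.1) ->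
  P (joint_le [seq (c * p.1, p.2) | p <- s]) =
  P (joint_le [seq (p.1, p.2 / k) | p <- s]).
Proof.
move=> spos; pose r := (fun p q : R * R => q.1 <= p.1).
have pe f : joint_le (map f s) = joint_le (map f (sort r s)).
  apply/funext => w; congr is_true; apply: perm_all.
  by apply: perm_map; rewrite perm_sym perm_sort.
rewrite !pe; apply: joint_le_scale_sorted.
  by apply: sort_sorted => p q; exact: le_total.
by move=> p; rewrite mem_sort; exact: spos.
Qed.

(** Joint distribution functions determine the law of a tuple, and dividing the bounds by [k]
    amounts to multiplying the process by [k]. *)
Lemma scaling_semi_selfsimilar H : k = c `^ H -> semi_selfsimilar c H Y.
Proof.
move=> kE; split=> // n t t0.
have -> : (fun w => [tuple c `^ H * Y (tnth t i) w | i < n]) =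
          (fun w => [tuple scale_mfun k (Y (tnth t i)) w | i < n]).
  by apply/funext => w; apply: eq_mktuple => i; rewrite /= kE mulrC.
apply: (@eq_law_tuple _ _ _ _ _ P P n (fun i => Y (c * tnth t i))
  (fun i => scale_mfun k (Y (tnth t i)))) => s.
have := @joint_le_scale [seq (tnth t p.1, p.2) | p <- s].
rewrite /joint_le -!map_comp => E.
transitivity (P (joint_le [seq (c * tnth t p.1, p.2) | p <- s])).
  by congr (P _); apply/funext => w; rewrite /joint_le /mkset all_map.
transitivity (P (joint_le [seq (tnth t p.1, p.2 / k) | p <- s])).
  by apply: E => _ /mapP[p _ ->] /=; exact: t0.
congr (P _); apply/funext => w; rewrite /joint_le /mkset all_map.
by congr is_true; apply: eq_all => p /=; rewrite ler_pdivlMr.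
Qed.

End extremal_joint.

(** * Max-autoregressive sequences *)

Section max_autoregression.
Context (R : realType) (d : measure_display) (T : measurableType d).
Context (P : probability T R) (X eps : nat -> {RV P >-> R}) (b : R).
Hypothesis b0 : 0 < b.
Local Notation D := [set n : nat | (1 <= n)%N].
Hypothesis eps_indep : mutually_indep D eps.
Hypothesis X0_indep : indep_of_family D (X 0%N) eps.
Hypothesis XE : forall n, (1 <= n)%N -> forall w,
  X n w = Num.max (b^-1 * X n.-1 w) (eps n w).

(** Induction with [u] general: the condition on [X n.+1] at [u] is one on [X n] at [b u] together
    with one on the last innovation. *)
Lemma max_ar_le n u w : (X n w <= u) <->
  (X 0%N w <= b ^+ n * u /\
   forall j, (1 <= j <= n)%N -> eps j w <= b ^+ (n - j) * u).
Proof.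
elim: n u => [|n IHn] u.
  rewrite expr0 mul1r; split=> [|[]//]; split=> // j.
  by case: j.
rewrite XE//= ge_max ler_pdivrMl//; split.
  move=> /andP[/IHn[X0 epsn] epsS]; rewrite exprSr -mulrA; split=> // j.
  move=> /andP[j1]; rewrite leq_eqVlt => /predU1P[->|jn].
    by rewrite subnn expr0 mul1r.
  by rewrite subSn// exprSr -mulrA epsn// j1.
move=> [X0 epsn]; apply/andP; split; last first.
  by have := epsn n.+1; rewrite ltnSn subnn expr0 mul1r; exact.
apply/IHn; rewrite mulrA -exprSr; split=> // j /andP[j1 jn].
by rewrite mulrA -exprSr -subSn// epsn// j1 ltnW.
Qed.

Lemma max_ar_cdf n u : cdfR (X n) u =
  cdfR (X 0%N) (b ^+ n * u) *
  \prod_(1 <= j < n.+1) cdfR (eps j) (b ^+ (n - j) * u).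
Proof.
apply: EFin_inj; rewrite EFinM -prodEFin !EFin_cdfR.
under eq_bigr do rewrite EFin_cdfR.
(* Mutual independence is stated over finite sets, so the range from 1 to [n] is turned into one. *)
pose J := seq_fset tt (index_iota 1 n.+1).
have JE j : (j \in J) = (1 <= j <= n)%N by rewrite seq_fsetE mem_index_iota.
pose B j := `]-oo, b ^+ (n - j) * u]%classic : set R.
have -> : X n @^-1` `]-oo, u] = X 0%N @^-1` `]-oo, b ^+ n * u] `&`
    \bigcap_(j in [set` J]) (eps j @^-1` B j).
  apply/seteqP; split=> w /=; rewrite !in_itv/=.
    move=> /max_ar_le[X0 epsn]; split=> // j /=.
    by rewrite JE /B/= in_itv => /epsn.
  move=> [X0 epsn]; apply/max_ar_le; split=> // j jn.
  by have := epsn j; rewrite /= JE jn /B/= in_itv; exact.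
have JD : [set` J] `<=` D by move=> j /=; rewrite JE => /andP[].
(* The joint event of the innovations lies in the sigma-algebra they generate, as a finite
   intersection. *)
rewrite X0_indep//; last first.
  apply: (@fin_bigcap_measurable _ (g_sigma_algebraType
    (\bigcup_(i in D) preimage_set_system [set: T] (eps i) measurable))) => // j jJ.
  by apply: sigma_family_preimage; [exact: JD|exact: measurable_itv].
rewrite eps_indep//; last by move=> j; exact: measurable_itv.
congr (_ * _)%E; apply: perm_big.
by apply: perm_trans (seq_fset_perm _ _) _; rewrite undup_id// iota_uniq.
Qed.

End max_autoregression.

Lemma prod_scaling_telescope (R : realType) (a b : R) (G : R -> R) :
  1 < a -> (forall u, 0 <= G u) -> (forall u, G (b * u) `^ a = G u) ->
  forall n u, G (b ^+ n * u) *
    \prod_(1 <= j < n.+1) G (b * (b ^+ (n - j) * u)) `^ (a - 1) = G u.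
Proof.
move=> a1 G0 GE n u; have a0 : 0 < a by apply: lt_trans a1.
under eq_big_nat => j /andP[j1 jn] do rewrite mulrA -exprS -subSn//.
(* Reversing the product makes its factors [G (b^(j+1) u) ^ (a-1)], free of [n]. In the induction
   the last factor then combines with [G (b^(n+1) u)] into [G (b^(n+1) u) ^ a = G (b^n u)]. *)
rewrite big_nat_rev/= big_add1/=.
under eq_big_nat => j /andP[_ jn] do
  rewrite add1n !subSS subSn ?leq_subr// subKn 1?ltnW//.
elim: n => [|n IHn]; first by rewrite big_geq// expr0 mul1r mulr1.
rewrite big_nat_recr//= mulrCA.
rewrite mulr_powRB1//.
by rewrite exprS -mulrA GE mulrC IHn.
Qed.

Theorem mainTheorem2 (R : realType) (alpha b a rho : R)
    (halpha : 0 < alpha) (hb : 1 < b) (ha : a = b `^ alpha)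
    (hrho : rho = 1 / b)
    (d : measure_display) (T : measurableType d) (P : probability T R)
    (Y : R -> {RV P >-> R})
    (hEP : extremal_process Y)
    (hstat : stationary_max_increments Y)
    (hnd : nondegenerate_df (cdfR (Y 1)))
    (d' : measure_display) (T' : measurableType d') (P' : probability T' R)
    (X eps : nat -> {RV P' >-> R})
    (hX0 : eq_law P' P (X 0%N) (Y 1))
    (hiid : iid [set n : nat | (1 <= n)%N] eps)
    (hindep : indep_of_family [set n : nat | (1 <= n)%N] (X 0%N) eps)
    (heps : forall n : nat, (1 <= n)%N ->
       eq_law P' P (eps n) (fun w => rho * Y (b `^ alpha - 1) w))
    (hX : forall n : nat, (1 <= n)%N -> forall w,
       X n w = Num.max (rho * X n.-1 w) (eps n w)) :
  (semi_selfsimilar a (1 / alpha) Y ->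
     marginally_stationary X /\
     (forall n : nat, frechet_max_semistable a b alpha (cdfR (X n)))) /\
  (marginally_stationary X ->
     semi_selfsimilar a (1 / alpha) Y /\
     (forall n : nat, frechet_max_semistable a b alpha (cdfR (X n)))).
Proof.
have b0 : 0 < b by apply: lt_trans hb.
have a1 : 1 < a by rewrite ha powR_gt1.
have a0 : 0 < a by apply: lt_trans a1.
have bE : a `^ (1 / alpha) = b.
  by rewrite ha -powRrM mulrC mulfVK ?powRr1 ?(ltW b0)// gt_eqF.
rewrite div1r in hrho; subst rho.
have [[U [YU _]] YG] := hstat.
have [eps_indep _] := hiid.
pose G := cdfR (Y 1).
have X0E : cdfR (X 0%N) =1 G by exact: eq_law_cdfR.
(* The innovation is at most [u] exactly when [Y (a - 1)] is at most [b u], in law; the time [a - 1]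
   is positive. *)
have epsE n : (1 <= n)%N -> forall u, cdfR (eps n) u = G (b * u) `^ (a - 1).
  move=> n1 u; rewrite -YG ?subr_gt0//.
  apply: EFin_inj; rewrite !EFin_cdfR heps// -ha.
  by congr (P _); apply/seteqP; split=> w /=; rewrite !in_itv/= ler_pdivrMl.
have XE n u : cdfR (X n) u = G (b ^+ n * u) *
    \prod_(1 <= j < n.+1) G (b * (b ^+ (n - j) * u)) `^ (a - 1).
  rewrite (max_ar_cdf b0 eps_indep hindep hX) X0E; congr (_ * _).
  by apply: eq_big_nat => j /andP[j1 _]; rewrite epsE.
have G0 u : 0 <= G u by exact/df_ge0/cdfR_df.
have frechet : (forall u, G (b * u) `^ a = G u) ->
    forall n, frechet_max_semistable a b alpha (cdfR (X n)).
  move=> GE n; have -> : cdfR (X n) = G.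
    by apply/funext => u; rewrite XE prod_scaling_telescope.
  by rewrite ha; apply: scaling_frechet; rewrite // -?ha//; exact: cdfR_df.
split=> [[_ Yss]|Xst].
  have GE u : G (b * u) `^ a = G u.
    rewrite -YG//; apply: EFin_inj; rewrite !EFin_cdfR.
    (* Only the one-dimensional marginal at time 1 is used, on the half-line up to [b u]. *)
    have := Yss 1%N [tuple 1] _ _ (measurable_tnth ord0 measurableT
      (measurable_itv `]-oo, b * u])).
    rewrite !setTI bE.
    have e (Z : R -> T -> R) : (fun w => [tuple Z (tnth [tuple 1] i) w | i < 1])
        @^-1` ((@tnth _ R)^~ ord0 @^-1` `]-oo, b * u]) = Z 1 @^-1` `]-oo, b * u].
      by apply/funext => w; rewrite /preimage/= tnth_mktuple.
    rewrite (e (fun t => Y (a * t))) (e (fun t w => b * Y t w)) mulr1.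
    move=> -> //; last by move=> i; rewrite (tnth_nth 0) ord1.
    by congr (P _); apply/seteqP; split=> w /=; rewrite !in_itv/= ler_pM2l.
  split; last exact: frechet.
  move=> n n1; apply: eq_law_cdf => u.
  by rewrite !XE !prod_scaling_telescope.
have GE u : G (b * u) `^ a = G u.
  (* Stationarity at [n = 1] suffices: the law of [X 1] is [G (b u) * G (b u) ^ (a-1)]. *)
  rewrite -mulr_powRB1// -[RHS]X0E -(eq_law_cdfR (Xst 1%N isT)) XE.
  by rewrite expr1 big_nat1 subnn expr0 mul1r.
split; last exact: frechet.
apply: (scaling_semi_selfsimilar YU YG a0 b0); last by rewrite bE.
(* The hypothesis on [G] with [c = a] and [k = b] is the functional equation at [u / b]. *)
by move=> u; rewrite -[RHS]GE mulrCA mulfV ?mulr1// gt_eqF.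
Qed.
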